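(* Let $n\ge 4$ and let $U_n$ be any connected unicyclic graph on $n$ vertices. Then \[ RRR(U_n)\ \ge\ \begin{cases} 1+2\sqrt{n-2}, & 4\le n\le 16,\\[2pt] 1+3\sqrt{2}+\sqrt{n-5}, & n\ge 17.\end{cases} \] For $4\le n\le 16$, equality holds if and only if $U_n\cong S_n^{+}$; for $n\ge 17$, equality holds if and only if $U_n\cong H_n$.
   Context: All graphs are simple, finite, undirected and connected; $d_u$ denotes the degree of vertex $u$. A connected graph on $n$ vertices is unicyclic if it has exactly $n$ edges. The reduced reciprocal Randić index of a graph $G$ is \[ RRR(G)=\sum_{uv\in E(G)}\sqrt{(d_u-1)(d_v-1)}. \] $S_n^{+}$ denotes the unicyclic graph obtained from the star $K_{1,n-1}$ by adding an edge between two of its pendent (degree-one) vertices (so $RRR(S_n^+)=1+2\sqrt{n-2}$). For $n\ge 6$, $H_n$ denotes the $n$-vertex unicyclic graph consisting of a triangle on vertices $y,a,b$, a vertex $w$ adjacent to $y$, a vertex $v$ adjacent to $w$, and $n-5$ pendent vertices all adjacent to $v$ (so $d_y=3$, $d_a=d_b=d_w=2$, $d_v=n-4$, and $RRR(H_n)=1+3\sqrt{2}+\sqrt{n-5}$). *)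

(* Defs.v *)
From HB Require Import structures.
From mathcomp Require Import all_boot all_order all_algebra all_fingroup.
Set Implicit Arguments. Unset Strict Implicit. Unset Printing Implicit Defensive.
Import Order.TTheory GRing.Theory Num.Theory.

Definition simple_graph (n : nat) (e : rel 'I_n) : Prop :=
  symmetric e /\ irreflexive e.

Definition graph_connected (n : nat) (e : rel 'I_n) : Prop :=
  forall x y : 'I_n, connect e x y.

Definition deg (n : nat) (e : rel 'I_n) (u : 'I_n) : nat := #|[pred v | e u v]|.

Definition edges (n : nat) (e : rel 'I_n) : {set 'I_n * 'I_n} :=
  [set p : 'I_n * 'I_n | (p.1 < p.2)%N && e p.1 p.2].

Definition unicyclic (n : nat) (e : rel 'I_n) : Prop :=
  simple_graph e /\ graph_connected e /\ #|edges e| = n.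

Definition RRR (R : rcfType) (n : nat) (e : rel 'I_n) : R :=
  \sum_(p in edges e)
     Num.sqrt (((deg e p.1).-1 * (deg e p.2).-1)%:R : R).

Definition isomorphic (n : nat) (e g : rel 'I_n) : Prop :=
  exists f : {perm 'I_n}, forall x y : 'I_n, e x y = g (f x) (f y).

(* S_n^+ : star centred at 0 with the extra edge {1,2} *)
Definition Splus_rel (i j : nat) : bool :=
  (i != j) && [|| i == 0%N, j == 0%N | ((i == 1%N) && (j == 2%N)) || ((i == 2%N) && (j == 1%N))].
Definition Splus (n : nat) : rel 'I_n := fun x y => Splus_rel x y.

(* H_n : triangle y=0,a=1,b=2; w=3 adjacent to y; v=4 adjacent to w;
   pendants 5..n-1 adjacent to v *)
Definition H_half (i j : nat) : bool :=
  [|| (i == 0%N) && (j == 1%N), (i == 0%N) && (j == 2%N), (i == 1%N) && (j == 2%N),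
      (i == 0%N) && (j == 3%N), (i == 3%N) && (j == 4%N) | (i == 4%N) && (5 <= j)%N].
Definition Hn (n : nat) : rel 'I_n := fun x y => H_half x y || H_half y x.

(* Main.v *)
Require Import Defs.
From HB Require Import structures.
From mathcomp Require Import all_boot all_order all_algebra all_fingroup.
From mathcomp Require Import all_solvable zify ring lra.
Set Implicit Arguments.
Unset Strict Implicit.
Unset Printing Implicit Defensive.
Import Order.TTheory GRing.Theory Num.Theory.
Local Open Scope ring_scope.

(** Only the core C, the subgraph on the vertices of degree at least 2, contributes
    to RRR.  Let k be the degree inside the core and r the degree minus 1; over the
    core the k's sum to 2|C| and the r's to n.  Since (sqrt r - 1)(sqrt r' - 1) >= 0
    on every edge, RRR is at least the sum of k sqrt r - 1 over C.
    Write p for the number of vertices with k = 1.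
    - If p = 0, the core is a cycle, and concavity of the square root moves all
      leaves to one vertex of a triangle: this is S_n^+.
    - Otherwise, concavity and a piecewise linear minorant of k sqrt (max (1, k - 1)),
      exact for k <= 3, bound RRR below by
      |C| - 1 + 3 (sqrt 2 - 1) p + sqrt (1 + n - |C| - p).
      When |C| + p >= 6 this is at least the value of H_n, with equality only for
      |C| = 5 and p = 1.
    - There remains the triangle with a pendent edge, |C| = 4 and p = 1, where RRR
      exceeds the smaller of the two values.
    With s = sqrt (n - 5), the two values compare as 2 sqrt (s^2 + 3) and
    3 sqrt 2 + s, which cross at s = 2 + sqrt 2, between n = 16 and n = 17. *)

Section SquareRoots.
Variable R : rcfType.
Implicit Types a b x y : R.

Lemma sqrtr_ge1 x : 1 <= x -> 1 <= Num.sqrt x.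
Proof. by move=> x1; rewrite -[leLHS]sqrtr1 ler_sqrt; lra. Qed.

Lemma sqrtr_gt1 x : 1 < x -> 1 < Num.sqrt x.
Proof. by move=> x1; rewrite -[ltLHS]sqrtr1 ltr_sqrt; lra. Qed.

Lemma leif_sqrt1D x y : 0 <= x -> 0 <= y ->
  Num.sqrt (1 + (x + y)) + 1 <= Num.sqrt (1 + x) + Num.sqrt (1 + y)
    ?= iff (x == 0) || (y == 0).
Proof.
move=> x_ge0 y_ge0; apply/leifP.
have [->|x_neq0] /= := eqVneq x 0; first by rewrite add0r addr0 sqrtr1 addrC.
have [->|y_neq0] /= := eqVneq y 0; first by rewrite !addr0 sqrtr1.
have sqrt_x_gt1 : 1 < Num.sqrt (1 + x) by apply: sqrtr_gt1; lra.
have sqrt_y_gt1 : 1 < Num.sqrt (1 + y) by apply: sqrtr_gt1; lra.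
have /sqr_sqrtr : 0 <= 1 + x by lra.
have /sqr_sqrtr : 0 <= 1 + y by lra.
have /sqr_sqrtr : 0 <= 1 + (x + y) by lra.
have := sqrtr_ge0 (1 + (x + y)); nra.
Qed.

Lemma leif_sqrtDr a x : 1 <= a -> 0 <= x ->
  Num.sqrt (a + x) <= Num.sqrt a + x / 2 ?= iff (x == 0).
Proof.
move=> a_ge1 x_ge0; apply/leifP.
have [->|x_neq0] := eqVneq x 0; first by rewrite mul0r !addr0.
have x_gt0 : 0 < x by rewrite lt_def x_neq0.
have := sqrtr_ge1 a_ge1; have := sqrtr_ge0 (a + x).
have /sqr_sqrtr : 0 <= a by lra.
have /sqr_sqrtr : 0 <= a + x by lra.
nra.
Qed.

(* Multiplied by the conjugates, this becomes
   [sqrt (b + x) + sqrt b <= sqrt b * (sqrt (1 + x) + 1) <= a * (sqrt (1 + x) + 1)]. *)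
Lemma leif_mulr_sqrtD a b x : 0 <= a -> 1 <= b <= a ^+ 2 -> 0 <= x ->
  a * Num.sqrt b + (Num.sqrt (1 + x) - 1) <= a * Num.sqrt (b + x)
    ?= iff (x == 0) || (a == 1).
Proof.
move=> a_ge0 /andP[b_ge1 b_le] x_ge0; apply/leifP.
have [->|x_neq0] /= := eqVneq x 0; first by rewrite addr0 sqrtr1 subrr !addr0.
have [a1|a_neq1] := eqVneq a 1.
  have -> : b = 1 by apply/le_anti; rewrite b_ge1 andbT; move: b_le; rewrite a1 expr1n.
  by rewrite a1 sqrtr1 !mul1r subrKC.
have x_gt0 : 0 < x by rewrite lt_def x_neq0.
have a_gt1 : 1 < a by rewrite lt_neqAle eq_sym a_neq1 /=; nra.
have sqrt_b_le : Num.sqrt b <= a.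
  by rewrite -(ger0_norm a_ge0) -sqrtr_sqr ler_sqrt; lra.
have /sqr_sqrtr b2 : 0 <= b by lra.
have /sqr_sqrtr bx2 : 0 <= b + x by lra.
have /sqr_sqrtr x2 : 0 <= 1 + x by lra.
have sqrt_b_ge1 := sqrtr_ge1 b_ge1; have sqrt_bx_ge0 := sqrtr_ge0 (b + x).
have sqrt_x_gt1 : 1 < Num.sqrt (1 + x) by apply: sqrtr_gt1; lra.
have sum_lt : Num.sqrt (b + x) + Num.sqrt b < a * (Num.sqrt (1 + x) + 1).
  have [b1|b_neq1] := eqVneq b 1; first by rewrite b1 sqrtr1; nra.
  have b_gt1 : 1 < b by rewrite lt_def b_neq1.
  have : Num.sqrt (b + x) < Num.sqrt b * Num.sqrt (1 + x).
    by rewrite -sqrtrM ?ltr_sqrt; nra.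
  by nra.
have sqrt_lt : Num.sqrt b < Num.sqrt (b + x) by rewrite ltr_sqrt; lra.
suff : (Num.sqrt (1 + x) - 1) * (Num.sqrt (1 + x) + 1) <
       a * (Num.sqrt (b + x) - Num.sqrt b) * (Num.sqrt (1 + x) + 1).
  by rewrite ltr_pM2r; lra.
have -> : (Num.sqrt (1 + x) - 1) * (Num.sqrt (1 + x) + 1) =
          (Num.sqrt (b + x) - Num.sqrt b) * (Num.sqrt (b + x) + Num.sqrt b) by nra.
by rewrite mulrAC [ltRHS]mulrC ltr_pM2l // subr_gt0.
Qed.

Lemma sqrt1D_sum (T : finType) (P : pred T) (F : T -> R) :
    (forall i, P i -> 0 <= F i) ->
  Num.sqrt (1 + \sum_(i | P i) F i) - 1 <= \sum_(i | P i) (Num.sqrt (1 + F i) - 1).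
Proof.
move=> F_ge0.
suff [] : 0 <= \sum_(i | P i) F i /\
    Num.sqrt (1 + \sum_(i | P i) F i) - 1 <=
    \sum_(i | P i) (Num.sqrt (1 + F i) - 1) by [].
elim/big_ind2: _ => [|x x' y y' [x_ge0 le_x] [y_ge0 le_y]|i /F_ge0 //].
  by rewrite addr0 sqrtr1 subrr.
split; first exact: addr_ge0.
by have := (leif_sqrt1D x_ge0 y_ge0).1; lra.
Qed.

Lemma sqrt1D_sum_eq (T : finType) (P : pred T) (F : T -> R) :
    (forall i, P i -> 0 <= F i) ->
    \sum_(i | P i) (Num.sqrt (1 + F i) - 1) = Num.sqrt (1 + \sum_(i | P i) F i) - 1 ->
  forall i j, P i -> P j -> i != j -> F i = 0 \/ F j = 0.
Proof.
move=> F_ge0 eq_sum i j Pi Pj ij.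
pose Q k := P k && (k != i) && (k != j).
have split_sum G : \sum_(k | P k) G k = (G i + G j) + \sum_(k | Q k) G k :> R.
  by rewrite (bigD1 i) //= (bigD1 j) ?Pj 1?eq_sym //= addrA.
have Fi := F_ge0 _ Pi; have Fj := F_ge0 _ Pj.
have FQ k : Q k -> 0 <= F k by move=> /andP[/andP[/F_ge0]].
have pair := leif_sqrt1D Fi Fj.
have sumQ_ge0 : 0 <= \sum_(k | Q k) F k by exact: sumr_ge0.
have rest := (leif_sqrt1D (addr_ge0 Fi Fj) sumQ_ge0).1.
have : (F i == 0) || (F j == 0).
  rewrite -(ge_leif pair); have := sqrt1D_sum FQ.
  by move: eq_sum rest; rewrite !split_sum /=; lra.
by case/orP => /eqP; [left | right].
Qed.

Lemma sqrt2_bounds : 7 / 5 < Num.sqrt (2 : R) < 10 / 7.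
Proof.
have : Num.sqrt (2 : R) ^+ 2 = 2 by rewrite sqr_sqrtr.
have := sqrtr_ge0 (2 : R) => s_ge0 s2; apply/andP; split; nra.
Qed.

Lemma sqr_sqrtD3_sub x : 0 <= x ->
  (2 * Num.sqrt (x + 3)) ^+ 2 - (3 * Num.sqrt 2 + Num.sqrt x) ^+ 2 =
  3 * (Num.sqrt x - Num.sqrt 2 + 2) * (Num.sqrt x - Num.sqrt 2 - 2).
Proof.
move=> x_ge0; have /sqr_sqrtr x2 := x_ge0.
have /sqr_sqrtr x3 : 0 <= x + 3 by lra.
have s2 : Num.sqrt (2 : R) ^+ 2 = 2 by rewrite sqr_sqrtr.
by rewrite exprMn x3; ring: x2 s2.
Qed.

Lemma triangle_pendant_gap x y : 2 <= x -> 0 < y ->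
  Num.min (2 * Num.sqrt (x + y)) (3 * Num.sqrt 2 + Num.sqrt (x + y - 3)) <
  Num.sqrt x * (2 + Num.sqrt y).
Proof.
move=> x_ge2 y_gt0; have /andP[s2_gt s2_lt] := sqrt2_bounds; rewrite gt_min.
have sx_ge0 := sqrtr_ge0 x; have sy_gt0 : 0 < Num.sqrt y by rewrite sqrtr_gt0.
have /sqr_sqrtr x2 : 0 <= x by lra.
have /sqr_sqrtr y2 : 0 <= y by lra.
(* Squaring and cancelling turns the first alternative into this inequality. *)
have [small|] := ltP (4 * Num.sqrt y) (x * (4 + Num.sqrt y)).
  apply/orP; left; rewrite -ltr_sqr ?nnegrE ?mulr_ge0 ?sqrtr_ge0 //; last by lra.
  by rewrite !exprMn sqr_sqrtr; nra.
move=> large; have x_lt4 : x < 4 by nra.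
have sy_ge4 : 4 <= Num.sqrt y by nra.
have sxy : Num.sqrt (x + y - 3) <= Num.sqrt y + 1 / 7.
  have /sqr_sqrtr xy2 : 0 <= x + y - 3 by nra.
  by rewrite -ler_sqr ?nnegrE ?sqrtr_ge0 ?xy2; nra.
have : Num.sqrt 2 * (2 + Num.sqrt y) <= Num.sqrt x * (2 + Num.sqrt y).
  by rewrite ler_wpM2r ?ler_sqrt; lra.
by move=> prod_le; apply/orP; right; nra.
Qed.

End SquareRoots.

Section ExtremalValues.
Variable R : rcfType.

Definition Splus_value (n : nat) : R := 1 + 2 * Num.sqrt (n - 2)%:R.
Definition Hn_value (n : nat) : R := 1 + 3 * Num.sqrt 2 + Num.sqrt (n - 5)%:R.

Lemma Splus_value_lt_Hn n : (n <= 16)%N -> Splus_value n < Hn_value n.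
Proof.
move=> n_le16; have /andP[s2_gt s2_lt] := sqrt2_bounds R.
have s_ge0 : 0 <= Num.sqrt (n - 5)%:R :> R by exact: sqrtr_ge0.
rewrite /Splus_value /Hn_value.
have [n_lt5|n_ge5] := ltnP n 5.
  have : Num.sqrt (n - 2)%:R <= Num.sqrt 2 :> R.
    by rewrite ler_sqrt ?ler_nat ?ler0n //; lia.
  by lra.
have -> : (n - 2 = n - 5 + 3)%N by lia.
rewrite natrD -addrA ltrD2l -ltr_sqr ?nnegrE; [|by rewrite mulr_ge0 ?sqrtr_ge0|by lra].
have s_lt : Num.sqrt (n - 5)%:R < 17 / 5 :> R.
  rewrite -ltr_sqr ?nnegrE ?sqr_sqrtr //; last by lra.
  have : (n - 5)%:R <= 11 :> R by rewrite ler_nat; lia.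
  by lra.
by rewrite -subr_lt0 sqr_sqrtD3_sub //; nra.
Qed.

Lemma Hn_value_lt_Splus n : (17 <= n)%N -> Hn_value n < Splus_value n.
Proof.
move=> n_ge17; have /andP[s2_gt s2_lt] := sqrt2_bounds R.
have s_ge0 : 0 <= Num.sqrt (n - 5)%:R :> R by exact: sqrtr_ge0.
rewrite /Splus_value /Hn_value.
have -> : (n - 2 = n - 5 + 3)%N by lia.
rewrite natrD -addrA ltrD2l -ltr_sqr ?nnegrE; [|by lra|by rewrite mulr_ge0 ?sqrtr_ge0].
have s_gt : 24 / 7 < Num.sqrt (n - 5)%:R :> R.
  rewrite -ltr_sqr ?nnegrE ?sqr_sqrtr //; last by lra.
  have : 12 <= (n - 5)%:R :> R by rewrite ler_nat; lia.
  by lra.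
by rewrite -subr_gt0 sqr_sqrtD3_sub //; nra.
Qed.

End ExtremalValues.

Section CoreWeights.
Variable R : rcfType.

Definition base_weight (j : nat) : R := j%:R * Num.sqrt (1 + j.-2%:R) - 1.

Definition linear_weight (j : nat) : R :=
  (1 < j)%:R + (3 * Num.sqrt 2 - 2) * j.-2%:R.

(* With [s = sqrt (j - 1)] and [t = sqrt 2], the difference of the two sides is
   [(s - 1) * (s - t) * (s + 3 - 2 * t)] for [j > 1]. *)
Lemma linear_weight_le j : (0 < j)%N -> linear_weight j <= base_weight j.
Proof.
have /andP[s2_gt s2_lt] := sqrt2_bounds R.
have s2 : Num.sqrt (2 : R) ^+ 2 = 2 by rewrite sqr_sqrtr.
case: j => [|[|[|j]]] // _; rewrite /linear_weight /base_weight /=.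
- by rewrite addr0 sqrtr1; lra.
- by rewrite addr0 sqrtr1; lra.
have -> : j.+3%:R = j.+1%:R + 2 :> R by rewrite -natrD addn2.
have : 1 <= j.+1%:R :> R by rewrite ler1n.
move: (j.+1%:R : R) => d d_ge1; pose s := Num.sqrt (1 + d).
have s_ge : Num.sqrt 2 <= s by rewrite ler_sqrt; lra.
have s_sq : s ^+ 2 = 1 + d by rewrite sqr_sqrtr; lra.
have : 0 <= (s - 1) * (s - Num.sqrt 2) * (s + 3 - 2 * Num.sqrt 2).
  by rewrite !mulr_ge0; lra.
suff -> : (s - 1) * (s - Num.sqrt 2) * (s + 3 - 2 * Num.sqrt 2) =
  (d + 2) * s - 1 - (1 + (3 * Num.sqrt 2 - 2) * d) by rewrite subr_ge0.
by ring: s2 s_sq.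
Qed.

End CoreWeights.

Section DegreeSequences.
Variables (R : rcfType) (T : finType) (C : {set T}) (k : T -> nat) (r : T -> R).
Hypothesis k_gt0 : forall v, v \in C -> (0 < k v)%N.
Hypothesis sum_k : (\sum_(v in C) k v = 2 * #|C|)%N.
(* By truncation, [1 + (k v).-2] is the maximum of [1] and [k v - 1]. *)
Hypothesis r_ge : forall v, v \in C -> 1 + (k v).-2%:R <= r v.

Definition pendants : {set T} := [set v in C | k v == 1%N].

Lemma sum_branching : (\sum_(v in C) (k v).-2 = #|pendants|)%N.
Proof.
have -> : (#|pendants| = \sum_(v in C) (k v == 1))%N.
  by rewrite -sum1dep_card big_mkcondr.
have : (\sum_(v in C) ((k v).-2 + 2) = \sum_(v in C) (k v + (k v == 1)))%N.
  by apply: eq_bigr => v /k_gt0; case: (k v) => [|[|]] //= ? _; rewrite addn0 addn2.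
by rewrite !big_split /= sum_k sum_nat_const mulnC [RHS]addnC => /addIn.
Qed.

Lemma no_pendants v : pendants = set0 -> v \in C -> k v = 2%N.
Proof.
move=> no_p vC; have := sum_branching; rewrite no_p cards0 => /eqP.
rewrite sum_nat_eq0 => /forall_inP/(_ v vC).
have : v \notin pendants by rewrite no_p inE.
by rewrite inE vC; have := k_gt0 vC; case: (k v) => [|[|[|]]].
Qed.

Lemma exists_branching : (0 < #|pendants|)%N -> exists2 y, y \in C & (2 < k y)%N.
Proof.
rewrite -sum_branching lt0n sum_nat_eq0 negb_forall => /existsP[y].
by rewrite negb_imply => /andP[yC ky]; exists y => //; lia.
Qed.

Lemma unique_branching : #|pendants| = 1%N ->
  exists2 y, y \in C & k y = 3%N /\ forall v, v \in C -> v != y -> (k v <= 2)%N.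
Proof.
move=> p1; have [|y yC ky] := exists_branching; first by rewrite p1.
have := sum_branching; rewrite p1 (bigD1 y) //= => sum1.
exists y => //; split=> [|v vC vy]; first by lia.
have : (\sum_(v in C | v != y) (k v).-2 == 0)%N by lia.
by rewrite sum_nat_eq0 => /forall_inP/(_ v); rewrite vC vy => /(_ isT); lia.
Qed.

Definition linear_bound : R := \sum_(v in C) (k v)%:R * (Num.sqrt (r v) - 1 / 2).

Lemma linear_boundE :
  linear_bound = \sum_(v in C) ((k v)%:R * Num.sqrt (r v) - 1).
Proof.
rewrite sumrB sumr_const; under [LHS]eq_bigr do rewrite mulrBr.
by rewrite sumrB -mulr_suml -natr_sum sum_k natrM; congr (_ - _); field.
Qed.

Definition surplus (v : T) : R := r v - 1 - (k v).-2%:R.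

Lemma surplus_ge0 v : v \in C -> 0 <= surplus v.
Proof. by move=> /r_ge; rewrite /surplus; lra. Qed.

Lemma sum_surplus :
  \sum_(v in C) surplus v = \sum_(v in C) r v - #|C|%:R - #|pendants|%:R.
Proof. by rewrite !sumrB sumr_const -natr_sum sum_branching. Qed.

Lemma sum_linear_weight :
  \sum_(v in C) linear_weight R (k v) =
  #|C|%:R + 3 * (Num.sqrt 2 - 1) * #|pendants|%:R.
Proof.
rewrite big_split /= -mulr_sumr -!natr_sum sum_branching.
have : (\sum_(v in C) (1 < k v) + #|pendants| = #|C|)%N.
  rewrite -!sum1dep_card !big_mkcondr -big_split -sum1_card /=.
  by apply: eq_bigr => v /k_gt0; case: (k v) => [|[|]].
by move/(congr1 (fun m => m%:R : R)); rewrite natrD => <-; ring.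
Qed.

Definition separated_bound : R :=
  \sum_(v in C) (base_weight R (k v) + (Num.sqrt (1 + surplus v) - 1)).

Lemma leif_separated_bound :
  separated_bound <= linear_bound
    ?= iff [forall (v | v \in C), (surplus v == 0) || (k v == 1%N)].
Proof.
rewrite linear_boundE; apply: leif_sum => v vC; rewrite /base_weight.
have b_bounds : 1 <= (1 + (k v).-2%:R : R) <= (k v)%:R ^+ 2.
  have : ((k v).-2.+1 <= k v * k v)%N.
    by have := k_gt0 vC; have := leq_pmulr (k v) (k_gt0 vC); lia.
  by rewrite -(ler_nat R) natrM -natr1 addrC expr2 => ->; rewrite andbT lerDl ler0n.
have := leif_mulr_sqrtD (ler0n R (k v)) b_bounds (surplus_ge0 vC).
have -> : 1 + (k v).-2%:R + surplus v = r v by rewrite /surplus; ring.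
rewrite pnatr_eq1 => /leifD/(_ (leif_eq (lexx (- 1)))).
by rewrite eqxx andbT addrAC.
Qed.

Lemma separated_bound_ge :
  #|C|%:R - 1 + 3 * (Num.sqrt 2 - 1) * #|pendants|%:R +
    Num.sqrt (1 + (\sum_(v in C) r v - #|C|%:R - #|pendants|%:R)) <= separated_bound.
Proof.
rewrite /separated_bound big_split /= -sum_surplus.
have := sqrt1D_sum surplus_ge0; have := sum_linear_weight.
have : \sum_(v in C) linear_weight R (k v) <=
       \sum_(v in C) base_weight R (k v).
  by apply: ler_sum => v /k_gt0; exact: linear_weight_le.
by lra.
Qed.

Lemma cycle_linear_boundE : pendants = set0 ->
  linear_bound = #|C|%:R + 2 * \sum_(v in C) (Num.sqrt (1 + surplus v) - 1).
Proof.
move=> no_p; rewrite linear_boundE mulr_sumr -sumr_const -big_split /=.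
by apply: eq_bigr => v vC; rewrite /surplus (no_pendants no_p) //= subr0 subrKC; ring.
Qed.

Lemma cycle_linear_bound : pendants = set0 ->
  #|C|%:R - 2 + 2 * Num.sqrt (1 + (\sum_(v in C) r v - #|C|%:R)) <= linear_bound.
Proof.
move=> no_p; rewrite cycle_linear_boundE //.
have := sqrt1D_sum surplus_ge0; have := sum_surplus; rewrite no_p cards0 subr0 => ->.
by lra.
Qed.

End DegreeSequences.

Section EdgeSums.
Variables (n : nat) (e : rel 'I_n).
Hypothesis simple_e : simple_graph e.

Lemma big_edges (V : Type) (idx : V) (op : Monoid.com_law idx)
    (F : 'I_n -> 'I_n -> V) : (forall x y, F x y = F y x) ->
  \big[op/idx]_x \big[op/idx]_(y | e x y) F x y =
  op (\big[op/idx]_(p in edges e) F p.1 p.2) (\big[op/idx]_(p in edges e) F p.1 p.2).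
Proof.
move=> F_sym; have [e_sym e_irr] := simple_e.
rewrite pair_big_dep /= (bigID (fun p : 'I_n * 'I_n => (p.1 < p.2)%N)) /=.
congr (op _ _); first by apply: eq_bigl => p; rewrite inE andbC.
rewrite (reindex (fun p : 'I_n * 'I_n => (p.2, p.1))) /=; last first.
  by exists (fun p => (p.2, p.1)) => -[].
apply: eq_big => [[x y]|[x y] _] /=; last exact: F_sym.
rewrite inE /= e_sym -leqNgt leq_eqVlt andbC.
case: (ltnP x y) => // _; rewrite ?orbT // orbF.
by case: eqP => // /val_inj ->; rewrite e_irr.
Qed.

Lemma degE x : deg e x = (\sum_(y | e x y) 1)%N.
Proof. by rewrite sum1_card. Qed.

Lemma sum_deg : (\sum_x deg e x = 2 * #|edges e|)%N.
Proof.
under eq_bigr => x _ do rewrite degE.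
by rewrite (@big_edges _ _ addn (fun _ _ => 1%N)) //= sum1_card mul2n addnn.
Qed.

Definition reduced_deg (x : 'I_n) : nat := (deg e x).-1.

Lemma RRR_double (R : rcfType) :
  RRR R e *+ 2 =
  \sum_x \sum_(y | e x y)
     Num.sqrt (reduced_deg x)%:R * Num.sqrt (reduced_deg y)%:R.
Proof.
rewrite big_edges => [|x y]; last exact: mulrC.
rewrite mulr2n; congr (_ + _);
by apply: eq_bigr => p _; rewrite -sqrtrM ?ler0n // natrM.
Qed.

End EdgeSums.

Section UniqSequences.
Variable T : finType.
Implicit Type r : seq T.

Lemma perm_map_uniq r r' : uniq r -> uniq r' -> size r' = size r ->
  exists f : {perm T}, r' = map f r.
Proof.
move=> uniq_r uniq_r' eq_size; have size_r : (size r <= #|T|)%N.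
  by rewrite -(card_uniqP uniq_r) max_card.
have /atransP2 := ntransitive_weak size_r (Sym_trans T).
have dtuple (s : (size r).-tuple T) : uniq s -> s \in (size r).-dtuple([set: T]).
  by move=> uniq_s; apply/dtuple_onP; split=> [|i]; [exact/tuple_uniqP | rewrite inE].
move=> /(_ (in_tuple r) (Tuple (introT eqP eq_size))).
rewrite !dtuple // => /(_ isT isT)[f _ /(congr1 val) /= ->].
by exists f.
Qed.

Lemma big_index (V : Type) (idx : V) (op : Monoid.com_law idx) (F : nat -> V) r :
    uniq r ->
  \big[op/idx]_(x : T) F (index x r) =
  op (\big[op/idx]_(i < size r) F i) (\big[op/idx]_(i < #|T| - size r) F (size r)).
Proof.
move=> uniq_r; rewrite (bigID (mem r)) /= -big_uniq //=; congr (op _ _).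
  case: r uniq_r => [|x0 r] uniq_r; first by rewrite big_nil big_ord0.
  rewrite (big_nth x0) big_mkord; apply: eq_bigr => i _.
  by rewrite index_uniq.
rewrite (eq_bigr (fun=> F (size r))) => [|x /memNindex-> //].
rewrite !big_const card_ord; congr iter.
have <- : (size r + #|[predC r]| = #|T|)%N by rewrite -(card_uniqP uniq_r) cardC.
by rewrite addKn.
Qed.

End UniqSequences.

Section Templates.
Variable n : nat.
Implicit Types (e g : rel 'I_n) (h : rel nat) (r : seq 'I_n).

(* All vertices outside [r] have index [size r], so that [h] describes them as twins
   of one another. *)
Definition realizes e h r : Prop :=
  uniq r /\ forall x y, e x y = h (index x r) (index y r).

Lemma isomorphic_realizes e g h r : realizes g h r ->
  isomorphic e g <-> exists r', size r' = size r /\ realizes e h r'.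
Proof.
move=> [uniq_r gE]; split=> [[f fE]|[r' [size_r' [uniq_r' eE]]]].
  exists (map (f^-1)%g r); split; first by rewrite size_map.
  split=> [|x y]; first by rewrite map_inj_uniq //; exact: perm_inj.
  by rewrite fE gE -{2}(permK f x) -{2}(permK f y) !index_map //; exact: perm_inj.
have [f rE] := perm_map_uniq uniq_r' uniq_r (esym size_r').
by exists f => x y; rewrite eE gE rE !index_map //; exact: perm_inj.
Qed.

Definition template_deg h (k i : nat) : nat :=
  (\sum_(j < k) h i j + (n - k) * h i k)%N.

Lemma deg_realizes e h r x :
  realizes e h r -> deg e x = template_deg h (size r) (index x r).
Proof.
case=> uniq_r eE; rewrite degE big_mkcond /=.
rewrite (eq_bigr (fun y => h (index x r) (index y r) : nat)) => [|y _]; last first.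
  by rewrite eE; case: (h _ _).
rewrite (@big_index _ _ _ addn (fun j => h (index x r) j : nat)) //=.
by rewrite sum_nat_const !card_ord.
Qed.

Lemma RRR_realizes (R : rcfType) e h r (rho : nat -> nat) :
    simple_graph e -> realizes e h r ->
    (forall i, (i <= size r)%N -> (template_deg h (size r) i).-1 = rho i) ->
    rho (size r) = 0%N ->
  RRR R e *+ 2 =
  \sum_(i < size r) \sum_(j < size r)
    (h i j)%:R * (Num.sqrt (rho i)%:R * Num.sqrt (rho j)%:R).
Proof.
move=> simple_e e_h rhoE rho0; have [uniq_r eE] := e_h.
have redE x : reduced_deg e x = rho (index x r).
  by rewrite -rhoE ?index_size // /reduced_deg (deg_realizes _ e_h).
pose F i j : R := (h i j)%:R * (Num.sqrt (rho i)%:R * Num.sqrt (rho j)%:R).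
have F0r i : F i (size r) = 0 by rewrite /F rho0 sqrtr0 !mulr0.
have F0l j : F (size r) j = 0 by rewrite /F rho0 sqrtr0 mul0r mulr0.
transitivity (\sum_x \sum_y F (index x r) (index y r)).
  rewrite RRR_double //; apply: eq_bigr => x _; rewrite big_mkcond.
  apply: eq_bigr => y _; rewrite /F -eE !redE.
  by case: (e x y); rewrite ?mul1r ?mul0r.
rewrite (big_index _ (fun i => \sum_y F i (index y r))) //=.
rewrite [X in _ + X]big1 ?addr0 => [|i _]; last exact: big1.
by apply: eq_bigr => i _; rewrite (big_index _ (F i)) //= [X in _ + X]big1 ?addr0.
Qed.

Lemma index_take_enum (k : nat) (x : 'I_n) :
  (k <= n)%N -> index x (take k (enum 'I_n)) = minn x k.
Proof.
move=> k_le_n; have size_take_enum : size (take k (enum 'I_n)) = k.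
  by rewrite size_takel // size_enum_ord.
have := index_enum_ord x; rewrite -{1}(cat_take_drop k (enum 'I_n)) index_cat.
case: ifP => [_ <-|/negbT/memNindex -> <-].
  by rewrite (minn_idPl _) // -[leqRHS]size_take_enum index_size.
by rewrite size_take_enum (minn_idPr _) ?leq_addr.
Qed.

Lemma realizes_Splus : (2 < n)%N ->
  realizes (@Splus n) Splus_rel (take 3 (enum 'I_n)).
Proof.
move=> n_gt2; split=> [|x y]; first by rewrite take_uniq ?enum_uniq.
rewrite !index_take_enum // /Splus; case: x y => [[|[|[|x]]] ?] [[|[|[|y]]] ?] //=;
  rewrite /Splus_rel ?minnSS ?minn0 /=; lia.
Qed.

Definition Hn_rel : rel nat := fun i j => H_half i j || H_half j i.

Lemma realizes_Hn : (4 < n)%N ->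
  realizes (@Hn n) Hn_rel (take 5 (enum 'I_n)).
Proof.
move=> n_gt4; split=> [|x y]; first by rewrite take_uniq ?enum_uniq.
rewrite !index_take_enum // /Hn /Hn_rel.
by case: x y => [[|[|[|[|[|x]]]]] ?] [[|[|[|[|[|y]]]]] ?] //=;
  rewrite ?minnSS ?minn0 /=; lia.
Qed.

Lemma isomorphic_SplusP e : (2 < n)%N ->
  isomorphic e (@Splus n) <-> exists r, size r = 3%N /\ realizes e Splus_rel r.
Proof.
move=> n_gt2; have := isomorphic_realizes e (realizes_Splus n_gt2).
by rewrite size_takel ?size_enum_ord.
Qed.

Lemma isomorphic_HnP e : (4 < n)%N ->
  isomorphic e (@Hn n) <-> exists r, size r = 5%N /\ realizes e Hn_rel r.
Proof.
move=> n_gt4; have := isomorphic_realizes e (realizes_Hn n_gt4).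
by rewrite size_takel ?size_enum_ord.
Qed.

Lemma RRR_Splus (R : rcfType) e : (2 < n)%N -> simple_graph e ->
  isomorphic e (@Splus n) -> RRR R e = Splus_value R n.
Proof.
move=> n_gt2 simple_e /(isomorphic_SplusP _ n_gt2)[r [size_r e_r]].
pose rho := nth 0%N [:: n - 2; 1; 1]%N.
have rhoE i : (i <= 3)%N -> (template_deg Splus_rel 3 i).-1 = rho i.
  rewrite /template_deg !big_ord_recl big_ord0 /rho.
  by case: i => [|[|[|[|//]]]] _; rewrite /bump /Splus_rel /= ?muln0 ?addn0; lia.
have := RRR_realizes R (rho := rho) simple_e e_r.
rewrite size_r => /(_ rhoE erefl).
rewrite !big_ord_recl !big_ord0 /bump /Splus_rel /rho /= sqrtr1 /Splus_value; lra.
Qed.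

Lemma RRR_Hn (R : rcfType) e : (5 < n)%N -> simple_graph e ->
  isomorphic e (@Hn n) -> RRR R e = Hn_value R n.
Proof.
move=> n_gt5 simple_e /(isomorphic_HnP _ (ltnW n_gt5))[r [size_r e_r]].
pose rho := nth 0%N [:: 2; 1; 1; 1; n - 5]%N.
have rhoE i : (i <= 5)%N -> (template_deg Hn_rel 5 i).-1 = rho i.
  rewrite /template_deg !big_ord_recl big_ord0 /rho.
  by case: i => [|[|[|[|[|[|//]]]]]] _;
    rewrite /bump /Hn_rel /H_half /= ?muln0 ?addn0; lia.
have := RRR_realizes R (rho := rho) simple_e e_r.
rewrite size_r => /(_ rhoE erefl).
rewrite !big_ord_recl !big_ord0 /bump /Hn_rel /H_half /rho /= sqrtr1 /Hn_value; lra.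
Qed.

End Templates.

Section Core.
Variables (R : rcfType) (n : nat) (e : rel 'I_n).
Hypothesis simple_e : simple_graph e.

Let e_sym : symmetric e := simple_e.1.
Let e_irr : irreflexive e := simple_e.2.

Definition core : {set 'I_n} := [set v | (1 < deg e v)%N].
Definition core_deg (v : 'I_n) : nat := #|[set u in core | e v u]|.

Definition leafless (v : 'I_n) : Prop := core_deg v = deg e v.
Definition leaf_hub (c : 'I_n) : Prop :=
  forall v, v \in core -> v != c -> leafless v.

Local Notation sqrt_red v := (Num.sqrt (reduced_deg e v)%:R : R).
Local Notation core_linear_bound :=
  (linear_bound core core_deg (fun v => (reduced_deg e v)%:R : R)).

Lemma core_degE v : core_deg v = (\sum_(u in core | e v u) 1)%N.
Proof. by rewrite /core_deg -sum1_card; apply: eq_bigl => u; rewrite inE. Qed.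

Lemma core_deg_le v : (core_deg v <= deg e v)%N.
Proof. by apply/subset_leq_card/subsetP => u; rewrite !inE => /andP[]. Qed.

Lemma core_deg_lt v : v \in core -> (core_deg v < #|core|)%N.
Proof.
move=> vC; rewrite (cardsD1 v core) vC add1n ltnS; apply/subset_leq_card/subsetP => u.
rewrite !inE => /andP[-> evu]; rewrite andbT.
by apply: contraTneq evu => ->; rewrite e_irr.
Qed.

Lemma reduced_deg_gt0 v : v \in core -> (0 < reduced_deg e v)%N.
Proof. by rewrite inE /reduced_deg; case: (deg e v) => [|[]]. Qed.

Lemma reduced_deg_ge v : v \in core -> ((core_deg v).-2 < reduced_deg e v)%N.
Proof. by rewrite inE /reduced_deg; have := core_deg_le v; lia. Qed.

Lemma leafless_neighbour v u : leafless v -> e v u -> u \in core.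
Proof.
move=> v_leafless evu; suff : u \in [set w in core | e v w] by rewrite inE => /andP[].
have -> : [set w in core | e v w] = [set w | e v w].
  apply/eqP; rewrite eqEcard [X in (_ <= X)%N]v_leafless cardsE leqnn andbT.
  by apply/subsetP => w; rewrite !inE => /andP[].
by rewrite inE.
Qed.

Lemma core_dominating v u :
  v \in core -> core_deg v = #|core|.-1 -> u \in core -> e v u = (u != v).
Proof.
move=> vC dom uC.
have : [set w in core | e v w] = core :\ v.
  apply/eqP; rewrite eqEcard [X in (_ <= X)%N]dom (cardsD1 v core) vC leqnn andbT.
  apply/subsetP => w; rewrite !inE => /andP[-> evw]; rewrite andbT.
  by apply: contraTneq evw => ->; rewrite e_irr.
by move/setP/(_ u); rewrite in_setD1 inE uC andbT.
Qed.

Lemma RRR_core :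
  RRR R e *+ 2 = \sum_(x in core) \sum_(y in core | e x y) sqrt_red x * sqrt_red y.
Proof.
rewrite RRR_double //.
have sqrt_red0 x : x \notin core -> sqrt_red x = 0.
  by rewrite inE -leqNgt /reduced_deg; case: (deg e x) => [|[]] // _; exact: sqrtr0.
rewrite (bigID (mem core)) /= [X in _ + X]big1 ?addr0 => [|x xC]; last first.
  by apply: big1 => y _; rewrite sqrt_red0 // mul0r.
apply: eq_bigr => x _; rewrite (bigID (mem core)) /= [X in _ + X]big1 ?addr0.
  by apply: eq_bigl => y; rewrite andbC.
by move=> y /andP[_ yC]; rewrite [sqrt_red y]sqrt_red0 // mulr0.
Qed.

Lemma RRR_sub_linear_bound :
  (RRR R e - core_linear_bound) *+ 2 =
  \sum_(x in core) \sum_(y in core | e x y) (sqrt_red x - 1) * (sqrt_red y - 1).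
Proof.
have sumL : \sum_(x in core) \sum_(y in core | e x y) sqrt_red x =
            \sum_(x in core) (core_deg x)%:R * sqrt_red x.
  apply: eq_bigr => x _; rewrite core_degE natr_sum mulr_suml.
  by apply: eq_bigr => y _; rewrite mul1r.
have sumR : \sum_(x in core) \sum_(y in core | e x y) sqrt_red y =
            \sum_(x in core) (core_deg x)%:R * sqrt_red x.
  rewrite -sumL (exchange_big_dep (mem core)) /=; last by move=> x y _ /andP[].
  by apply: eq_bigr => y yC; apply: eq_bigl => x; rewrite e_sym yC.
have sum1 : \sum_(x in core) \sum_(y in core | e x y) 1 =
            \sum_(x in core) (core_deg x)%:R :> R.
  by apply: eq_bigr => x _; rewrite core_degE natr_sum.
transitivity (\sum_(x in core) (\sum_(y in core | e x y) sqrt_red x * sqrt_red y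
    - \sum_(y in core | e x y) sqrt_red x - \sum_(y in core | e x y) sqrt_red y
    + \sum_(y in core | e x y) 1)).
  rewrite big_split /= sum1 !sumrB sumL sumR -RRR_core /linear_bound.
  under [X in _ - X]eq_bigr do rewrite mulrBr.
  by rewrite sumrB -mulr_suml; field.
by apply: eq_bigr => x _; rewrite -!sumrB -big_split /=; apply: eq_bigr => y _; ring.
Qed.

Lemma sqrt_red_ge1 x : x \in core -> 1 <= sqrt_red x.
Proof. by move=> xC; rewrite sqrtr_ge1 // ler1n reduced_deg_gt0. Qed.

Lemma leif_RRR_linear_bound :
  core_linear_bound <= RRR R e ?= iff
    [forall (x | x \in core), [forall (y | (y \in core) && e x y),
       (reduced_deg e x == 1%N) || (reduced_deg e y == 1%N)]].
Proof.
have sqrt_red_eq1 v : (sqrt_red v - 1 == 0) = (reduced_deg e v == 1%N).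
  by rewrite subr_eq0 -[X in _ == X]sqrtr1 eqr_sqrt ?ler0n ?ler01 // pnatr_eq1.
have /leif_0_sum-[] : forall x, x \in core ->
    0 <= \sum_(y in core | e x y) (sqrt_red x - 1) * (sqrt_red y - 1) ?= iff
      [forall (y | (y \in core) && e x y),
         (reduced_deg e x == 1%N) || (reduced_deg e y == 1%N)].
  move=> x /sqrt_red_ge1 x1; apply: leif_0_sum => y /andP[/sqrt_red_ge1 y1 _].
  by rewrite -!sqrt_red_eq1 -mulf_eq0 eq_sym; apply/leif_eq; rewrite mulr_ge0 ?subr_ge0.
rewrite -RRR_sub_linear_bound (pmulrn_lge0 _ (ltn0Sn 1)) subr_ge0 => le_L <-.
by split=> //; rewrite [RHS]eq_sym mulrn_eq0 subr_eq0 eq_sym.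
Qed.

Lemma linear_bound_le : core_linear_bound <= RRR R e.
Proof. exact: leif_RRR_linear_bound.1. Qed.

(* The vertex [y] is joined to the rest of the core, and exactly one further edge
   remains in the core. *)
Lemma dominating_bound y :
    (\sum_(v in core) core_deg v = 2 * #|core|)%N ->
    y \in core -> core_deg y = #|core|.-1 ->
  1 + sqrt_red y * (\sum_(v in core :\ y) sqrt_red v) <= RRR R e.
Proof.
move=> sum_k yC dom; rewrite -subr_ge0 -(pmulrn_lge0 _ (ltn0Sn 1)) mulrnBl RRR_core.
have adj v : v \in core -> e y v = (v != y) by exact: core_dominating.
rewrite (big_setD1 y yC) /=.
have -> : \sum_(v in core | e y v) sqrt_red y * sqrt_red v =
          sqrt_red y * \sum_(v in core :\ y) sqrt_red v.
  rewrite mulr_sumr; apply: eq_bigl => v; rewrite in_setD1 andbC.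
  by have [/adj->|] := boolP (v \in core); rewrite ?andbT ?andbF.
have card_edges : \sum_(v in core :\ y) ((core_deg v)%:R - 1) = 2 :> R.
  have sumD : (\sum_(v in core :\ y) core_deg v = #|core :\ y| + 2)%N.
    by move: sum_k; rewrite (big_setD1 y yC) dom (cardsD1 y core) yC /=; lia.
  by rewrite sumrB sumr_const -natr_sum sumD natrD addrAC subrr add0r.
have : \sum_(v in core :\ y) (sqrt_red v * sqrt_red y + ((core_deg v)%:R - 1)) <=
       \sum_(v in core :\ y) \sum_(w in core | e v w) sqrt_red v * sqrt_red w.
  apply: ler_sum => v /setD1P[vy vC]; rewrite core_degE natr_sum.
  have evy : (y \in core) && e v y by rewrite yC e_sym adj.
  rewrite (bigD1 y evy) [X in _ <= X](bigD1 y evy) /= addrAC subrr add0r lerD2l.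
  apply: ler_sum => w /andP[/andP[wC _] _].
  by rewrite mulr_ege1 ?sqrt_red_ge1.
rewrite big_split /= card_edges -mulr_suml; lra.
Qed.

End Core.

Section Connected.
Variables (n : nat) (e : rel 'I_n).
Hypothesis n_gt2 : (2 < n)%N.
Hypothesis simple_e : simple_graph e.
Hypothesis connected_e : graph_connected e.

Let e_sym : symmetric e := simple_e.1.
Let e_irr : irreflexive e := simple_e.2.

Lemma connected_closed_setT (S : {set 'I_n}) x :
  x \in S -> (forall u v, u \in S -> e u v -> v \in S) -> S = setT.
Proof.
move=> xS closedS; apply/setP => y; rewrite inE.
have clS : closed e (mem S).
  apply: intro_closed => [|u v euv uS]; first exact: sym_connect_sym.
  exact: closedS euv.
by rewrite -(closed_connect clS (connected_e x y)).
Qed.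

Lemma connected_closed_card (S : {set 'I_n}) x :
  x \in S -> (forall u v, u \in S -> e u v -> v \in S) -> #|S| = n.
Proof. by move=> xS /(connected_closed_setT xS)->; rewrite cardsT card_ord. Qed.

Lemma deg_gt0 v : (0 < deg e v)%N.
Proof.
rewrite lt0n; apply/negP => /eqP /card0_eq isolated.
have := @connected_closed_card [set v] v (set11 v); rewrite cards1 => card1.
suff : 1%N = n by lia.
by apply: card1 => u w /set1P-> evw; have := isolated w; rewrite inE evw.
Qed.

Lemma leaf_neighbour_uniq y z w : y \notin core e -> e y z -> e y w -> w = z.
Proof.
rewrite inE -leqNgt => y1 eyz eyw.
have /cards1P[t tE] : #|[set w | e y w]| == 1%N.
  by rewrite cardsE -[#|_|]/(deg e y) eqn_leq y1 deg_gt0.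
have : w \in [set w | e y w] by rewrite inE.
have : z \in [set w | e y w] by rewrite inE.
by rewrite tE => /set1P-> /set1P->.
Qed.

Lemma leaf_neighbour x u : x \notin core e -> e x u -> u \in core e.
Proof.
move=> x_leaf exu; apply/negPn/negP => u_leaf.
have := @connected_closed_card [set x; u] x (set21 x u); rewrite cards2 => card2.
suff : (x != u).+1 = n by case: (x != u) => /=; lia.
apply: card2 => y w /set2P[] -> eyw; rewrite !inE.
  by rewrite (leaf_neighbour_uniq x_leaf exu eyw) eqxx orbT.
by rewrite e_sym in exu; rewrite (leaf_neighbour_uniq u_leaf exu eyw) eqxx.
Qed.

Lemma leaf_hub_adjacent c x u : leaf_hub e c -> u \notin core e -> e x u = (x == c).
Proof.
move=> c_hub u_leaf; have only_c y : e y u -> y = c.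
  move=> eyu; apply: (contraNeq _ u_leaf) => yc; apply: (leafless_neighbour _ eyu).
  by apply: c_hub => //; apply: (leaf_neighbour u_leaf); rewrite e_sym.
apply/idP/eqP => [|->]; first exact: only_c.
have /card_gt0P[w] := deg_gt0 u.
by rewrite inE e_sym => ewu; rewrite -(only_c _ ewu).
Qed.

Lemma sum_reduced_deg :
  (\sum_(v in core e) reduced_deg e v + n = 2 * #|edges e|)%N.
Proof.
rewrite -(sum_deg simple_e).
have -> : (\sum_(v in core e) reduced_deg e v = \sum_v reduced_deg e v)%N.
  rewrite [RHS](bigID (mem (core e))) /= [X in (_ + X)%N]big1 ?addn0 // => v.
  by rewrite inE /reduced_deg; case: (deg e v) => [|[]].
rewrite -[X in (_ + X)%N](card_ord n) -sum1_card -big_split /=.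
by apply: eq_bigr => v _; rewrite addn1 prednK ?deg_gt0.
Qed.

Lemma sum_core_deg :
  (\sum_(v in core e) core_deg e v + 2 * n = 2 * #|edges e| + 2 * #|core e|)%N.
Proof.
have split_deg : (\sum_(v in core e) (reduced_deg e v + 1) =
    \sum_(v in core e) core_deg e v +
    \sum_(v in core e) \sum_(u | (u \notin core e) && e v u) 1)%N.
  rewrite -big_split; apply: eq_bigr => v _.
  rewrite addn1 prednK ?deg_gt0 // core_degE degE (bigID (mem (core e))) /=.
  by congr (_ + _)%N; apply: eq_bigl => u; rewrite andbC.
have leaves : (\sum_(v in core e) \sum_(u | (u \notin core e) && e v u) 1 =
               #|~: core e|)%N.
  rewrite (exchange_big_dep (fun u => u \notin core e)) /= => [|v u _ /andP[] //].
  rewrite -sum1_card; under [RHS]eq_bigl do rewrite inE.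
  apply: eq_bigr => u uC; transitivity (deg e u).
    rewrite degE; apply: eq_bigl => v; rewrite uC e_sym /= andbC.
    by case euv: (e u v); rewrite //= (leaf_neighbour uC euv).
  by apply/eqP; rewrite eqn_leq deg_gt0 andbT leqNgt; move: uC; rewrite inE.
have card_leaves : (#|core e| + #|~: core e| = n)%N by rewrite cardsC card_ord.
move: split_deg card_leaves sum_reduced_deg.
by rewrite leaves big_split /= sum1_card /reverse_coercion /=; lia.
Qed.

Lemma core_realizes (h : rel nat) (r : seq 'I_n) (c : 'I_n) :
    symmetric h -> irreflexive h ->
    uniq r -> core e =i r -> c \in r -> leaf_hub e c ->
    (forall i, (i < size r)%N -> h i (size r) = (i == index c r)) ->
    (forall i j, (i < j < size r)%N -> e (nth c r i) (nth c r j) = h i j) ->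
  realizes e h r.
Proof.
move=> h_sym h_irr uniq_r rE cr c_hub h_leaf h_core.
have core_leaf x y : x \in r -> y \notin r -> e x y = h (index x r) (index y r).
  move=> xr yr; rewrite (memNindex yr) h_leaf ?index_mem //.
  rewrite (leaf_hub_adjacent _ c_hub) ?rE //.
  by apply/eqP/eqP => [->//|/(index_inj c xr cr)].
have core_core x y : x \in r -> y \in r -> (index x r < index y r)%N ->
    e x y = h (index x r) (index y r).
  by move=> xr yr lt_xy; rewrite -h_core ?lt_xy ?index_mem // !nth_index.
split=> // x y; have [xr|xr] := boolP (x \in r); have [yr|yr] := boolP (y \in r).
- case: (ltngtP (index x r) (index y r)) => [lt_xy|lt_yx|eq_xy].
  + exact: core_core.
  + by rewrite e_sym h_sym core_core.
  + by rewrite (index_inj c xr yr eq_xy) e_irr h_irr.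
- exact: core_leaf.
- by rewrite e_sym h_sym core_leaf.
rewrite (memNindex xr) (memNindex yr) h_irr; apply/negbTE/negP => exy.
have := leaf_neighbour _ exy.
by rewrite !rE (negPf yr) => /(_ xr).
Qed.

End Connected.

Section Unicyclic.
Variables (R : rcfType) (n : nat) (e : rel 'I_n).
Hypothesis n_ge4 : (4 <= n)%N.
Hypothesis unicyclic_e : unicyclic e.

Let n_gt2 : (2 < n)%N := ltnW n_ge4.
Let simple_e : simple_graph e := unicyclic_e.1.
Let connected_e : graph_connected e := unicyclic_e.2.1.
Let e_sym : symmetric e := simple_e.1.
Let e_irr : irreflexive e := simple_e.2.

Local Notation C := (core e).
Local Notation k := (core_deg e).
Local Notation P := (pendants C k).
Local Notation rho := (fun v => (reduced_deg e v)%:R : R).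

Lemma sum_core_deg_unicyclic : (\sum_(v in C) k v = 2 * #|C|)%N.
Proof.
have := sum_core_deg n_gt2 simple_e connected_e; rewrite unicyclic_e.2.2; lia.
Qed.
Let sum_k := sum_core_deg_unicyclic.

Lemma sum_reduced_deg_unicyclic : (\sum_(v in C) reduced_deg e v = n)%N.
Proof.
have := sum_reduced_deg n_gt2 simple_e connected_e; rewrite unicyclic_e.2.2; lia.
Qed.

Lemma sum_rho : \sum_(v in C) rho v = n%:R.
Proof. by rewrite -natr_sum sum_reduced_deg_unicyclic. Qed.

Lemma core_deg_gt0 v : v \in C -> (0 < k v)%N.
Proof.
move=> vC; rewrite lt0n; apply/eqP => /eqP; rewrite cards_eq0 => /eqP/setP no_core.
have leaf u : e v u -> u \notin C.
  by move=> evu; have := no_core u; rewrite in_set0 inE evu andbT => ->.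
have star : v |: [set u | e v u] = setT.
  apply: (connected_closed_setT simple_e connected_e (setU11 _ _)) => x w.
  rewrite !inE => /orP[/eqP->->|evx exw]; first exact: orbT.
  have xC := leaf _ evx; rewrite e_sym in evx.
  by rewrite (leaf_neighbour_uniq n_gt2 simple_e connected_e xC evx exw) eqxx.
have core1 : C = [set v].
  apply/eqP; rewrite eqEsubset sub1set vC andbT; apply/subsetP => u uC.
  have /setP/(_ u) := star; rewrite !inE; case: eqP => //= _ /leaf.
  by rewrite uC.
have := core_deg_lt simple_e vC; have := sum_k; rewrite core1 big_set1 cards1; lia.
Qed.
Let k_gt0 := core_deg_gt0.

Lemma rho_ge v : v \in C -> 1 + (k v).-2%:R <= rho v.
Proof. by move/reduced_deg_ge; rewrite -(ler_nat R) -natr1 addrC. Qed.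

Lemma card_core_pendants_le : (#|C| + #|P| <= n)%N.
Proof.
rewrite -[leqRHS]sum_reduced_deg_unicyclic -sum1_card.
rewrite -(sum_branching k_gt0 sum_k) -big_split.
by apply: leq_sum => v /reduced_deg_ge.
Qed.

Lemma leafless_reduced_deg v : rho v = 1 + (k v).-2%:R -> (1 < k v)%N -> leafless e v.
Proof.
by rewrite addrC natr1 => /eqP; rewrite eqr_nat /leafless /reduced_deg => /eqP; lia.
Qed.

Lemma core_card_gt2 : (2 < #|C|)%N.
Proof.
have [v vC|C0] := pickP (mem C); last first.
  by have := sum_reduced_deg_unicyclic; rewrite big_pred0 //; lia.
have : (\sum_(v in C) k v <= \sum_(v in C) #|C|.-1)%N.
  by apply: leq_sum => u /(core_deg_lt simple_e); lia.
by rewrite sum_k sum_nat_const; have := core_deg_lt simple_e vC; nia.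
Qed.

Lemma core_card_gt3 : (0 < #|P|)%N -> (3 < #|C|)%N.
Proof.
move/(exists_branching k_gt0 sum_k) => [y yC ky].
by have := core_deg_lt simple_e yC; lia.
Qed.

Lemma leif_cycle_bound : P = set0 ->
  Splus_value R n <= #|C|%:R - 2 + 2 * Num.sqrt (1 + (n%:R - #|C|%:R))
    ?= iff (#|C| == 3%N).
Proof.
move=> no_p; have C3 : 3 <= #|C|%:R :> R by rewrite (ler_nat _ 3) core_card_gt2.
have Cn : #|C|%:R <= n%:R :> R by rewrite ler_nat; have := card_core_pendants_le; lia.
have b_ge1 : 1 <= 1 + (n%:R - #|C|%:R) :> R by lra.
have c_ge0 : 0 <= #|C|%:R - 3 :> R by lra.
have := leif_sqrtDr b_ge1 c_ge0.
rewrite subr_eq0 (eqr_nat _ _ 3) => -[le_sqrt eq_sqrt].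
have sqrtE : Num.sqrt (n - 2)%:R = Num.sqrt (1 + (n%:R - #|C|%:R) + (#|C|%:R - 3)) :> R.
  by rewrite natrB; [congr Num.sqrt; ring | lia].
rewrite /Splus_value sqrtE; split; first by lra.
rewrite -eq_sqrt; apply/eqP/eqP; lra.
Qed.

Lemma cycle_RRR_ge : P = set0 -> Splus_value R n <= RRR R e.
Proof.
move=> no_p; apply: le_trans (leif_cycle_bound no_p).1 _.
apply: le_trans (linear_bound_le R simple_e).
by rewrite -sum_rho; exact: (cycle_linear_bound k_gt0 sum_k rho_ge).
Qed.

Lemma cycle_RRR_eq : P = set0 -> RRR R e = Splus_value R n ->
  #|C| = 3%N /\ forall u v, u \in C -> v \in C -> u != v ->
    leafless e u \/ leafless e v.
Proof.
move=> no_p RRR_eq; have k2 v : v \in C -> k v = 2%N by exact: no_pendants.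
have := linear_bound_le R simple_e; have := cycle_linear_bound k_gt0 sum_k rho_ge no_p.
rewrite sum_rho RRR_eq (cycle_linear_boundE rho k_gt0 sum_k no_p) => bound_le le_RRR.
have C3 : #|C| = 3%N by apply/eqP; rewrite -(ge_leif (leif_cycle_bound no_p)); lra.
split=> // u v uC vC uv.
have no_surplus w : w \in C -> surplus k rho w = 0 -> leafless e w.
  move=> wC; rewrite /surplus => surplus0.
  by apply: leafless_reduced_deg; [lra | rewrite k2].
have merged : \sum_(w in C) (Num.sqrt (1 + surplus k rho w) - 1) =
              Num.sqrt (1 + \sum_(w in C) surplus k rho w) - 1.
  rewrite (sum_surplus rho k_gt0 sum_k) sum_rho no_p cards0 subr0.
  by have := (leif_cycle_bound no_p).1; lra.
have [/(no_surplus _ uC)|/(no_surplus _ vC)] :=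
  sqrt1D_sum_eq (surplus_ge0 rho_ge) merged uC vC uv; by [left | right].
Qed.

Lemma cycle_hub : P = set0 -> RRR R e = Splus_value R n ->
  exists2 z, z \in C & leaf_hub e z.
Proof.
move=> no_p /(cycle_RRR_eq no_p)[C3 leafless_pair].
have [z /andP[zC z_leaves]|all_leafless] := pickP [pred z in C | k z != deg e z].
  exists z => // v vC vz; have [//|z_leafless] := leafless_pair v z vC zC vz.
  by rewrite z_leafless eqxx in z_leaves.
have /card_gt0P[z zC] : (0 < #|C|)%N by rewrite C3.
by exists z => // v vC _; have := all_leafless v; rewrite /= vC => /negbFE/eqP.
Qed.

Lemma cycle_isomorphic : P = set0 -> RRR R e = Splus_value R n ->
  isomorphic e (@Splus n).
Proof.
move=> no_p RRR_eq; have [C3 _] := cycle_RRR_eq no_p RRR_eq.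
have [z zC z_hub] := cycle_hub no_p RRR_eq.
have k2 v : v \in C -> k v = 2%N by exact: no_pendants.
apply/(isomorphic_SplusP _ n_gt2); exists (z :: enum (C :\ z)).
have size_r : size (z :: enum (C :\ z)) = 3%N.
  by rewrite /= -cardE; apply/eqP; rewrite -(eqn_add2l (z \in C)) addnS -cardsD1 C3 zC.
have uniq_r : uniq (z :: enum (C :\ z)) by rewrite /= mem_enum !inE eqxx enum_uniq.
have rE : C =i z :: enum (C :\ z).
  by move=> v; rewrite in_cons mem_enum in_setD1; case: eqP => // ->.
split=> //; apply: (core_realizes n_gt2 simple_e connected_e (c := z)) => //.
- by move=> i j; rewrite /Splus_rel; lia.
- by move=> i; rewrite /Splus_rel eqxx.
- exact: mem_head.
- by rewrite size_r => -[|[|[|[]]]] //=; rewrite eqxx.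
move=> i j /andP[ij j_lt]; have i_lt := ltn_trans ij j_lt.
have inC m : (m < size (z :: enum (C :\ z)))%N -> nth z (z :: enum (C :\ z)) m \in C.
  by move=> m_lt; rewrite rE mem_nth.
rewrite (core_dominating simple_e (inC _ i_lt)) ?k2 ?inC ?C3 // nth_uniq // eq_sym.
by move: ij j_lt; rewrite size_r /Splus_rel; lia.
Qed.

Lemma leif_branching_bound : (0 < #|P|)%N -> (6 <= #|C| + #|P|)%N ->
  Hn_value R n <= #|C|%:R - 1 + 3 * (Num.sqrt 2 - 1) * #|P|%:R +
                  Num.sqrt (1 + (n%:R - #|C|%:R - #|P|%:R))
    ?= iff (#|C| == 5%N) && (#|P| == 1%N).
Proof.
move=> p_gt0 six.
have c_gt3 := core_card_gt3 p_gt0; have cp_le := card_core_pendants_le.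
have /andP[s2_gt s2_lt] := sqrt2_bounds R.
move: #|C| #|P| p_gt0 six c_gt3 cp_le => c p p_gt0 six c_gt3 cp_le.
have b_ge1 : 1 <= 1 + (n%:R - c%:R - p%:R) :> R.
  have : (c + p)%:R <= n%:R :> R by rewrite ler_nat.
  by rewrite natrD; lra.
have d_ge0 : 0 <= c%:R + p%:R - 6 :> R by rewrite -natrD subr_ge0 (ler_nat _ 6).
have := (leif_sqrtDr b_ge1 d_ge0).1.
have -> : 1 + (n%:R - c%:R - p%:R) + (c%:R + p%:R - 6) = (n - 5)%:R :> R.
  by rewrite natrB; [ring | lia].
move=> sqrt_le; rewrite /Hn_value; apply/leifP; case: ifP => [/andP[/eqP-> /eqP->]|].
  have -> : (n - 5)%:R = 1 + (n%:R - 5 - 1) :> R by rewrite natrB; [ring | lia].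
  by apply/eqP; ring.
have p_ge1 : 1 <= p%:R :> R by rewrite ler1n.
move=> /negbT cp_neq; have [c_ge6|c_le5] := leqP 6 c.
  have : 6 <= c%:R :> R by rewrite (ler_nat _ 6).
  by nra.
have : 4 <= c%:R :> R by rewrite (ler_nat _ 4).
have : 2 <= p%:R :> R by rewrite (ler_nat _ 2); lia.
by nra.
Qed.

Lemma branching_RRR_ge : (0 < #|P|)%N -> (6 <= #|C| + #|P|)%N ->
  Hn_value R n <= RRR R e.
Proof.
move=> p_gt0 six; apply: le_trans (leif_branching_bound p_gt0 six).1 _.
apply: le_trans (linear_bound_le R simple_e).
apply: le_trans (leif_separated_bound k_gt0 sum_k rho_ge).1.
by have := separated_bound_ge k_gt0 sum_k rho_ge; rewrite sum_rho.
Qed.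

Lemma branching_RRR_eq : (0 < #|P|)%N -> (6 <= #|C| + #|P|)%N ->
    RRR R e = Hn_value R n ->
  [/\ #|C| = 5%N, #|P| = 1%N, forall v, v \in C -> k v != 1%N -> leafless e v &
    forall x y, x \in C -> y \in C -> e x y ->
      (reduced_deg e x == 1%N) || (reduced_deg e y == 1%N)].
Proof.
move=> p_gt0 six RRR_eq; have bound := leif_branching_bound p_gt0 six.
have separated := separated_bound_ge k_gt0 sum_k rho_ge; rewrite sum_rho in separated.
have linear := leif_separated_bound k_gt0 sum_k rho_ge.
have := leif_RRR_linear_bound R simple_e; rewrite RRR_eq => edges.
have /andP[/eqP c5 /eqP p1] : (#|C| == 5%N) && (#|P| == 1%N).
  by rewrite -(ge_leif bound); move: linear.1 edges.1; lra.
have /forall_inP no_surplus :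
    [forall (v | v \in C), (surplus k rho v == 0) || (k v == 1%N)].
  by rewrite -(ge_leif linear); move: bound.1 edges.1; lra.
have /forall_inP adjacent : [forall (x | x \in C), [forall (y | (y \in C) && e x y),
    (reduced_deg e x == 1%N) || (reduced_deg e y == 1%N)]].
  by rewrite -(ge_leif edges); move: bound.1 linear.1; lra.
split=> // [v vC kv|x y xC yC exy].
  have := no_surplus v vC; rewrite (negPf kv) orbF /surplus => /eqP surplus0.
  apply: leafless_reduced_deg; first by lra.
  by have := k_gt0 vC; lia.
by have /forall_inP := adjacent x xC; apply; rewrite yC.
Qed.

Lemma core_deg_seq r x : uniq r -> C =i r -> k x = count (e x) r.
Proof.
move=> uniq_r rE; rewrite -size_filter -(card_uniqP (filter_uniq _ uniq_r)).
by apply: eq_card => u; rewrite inE mem_filter rE andbC.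
Qed.

Lemma triangle_pendant_RRR_gt : #|C| = 4%N -> #|P| = 1%N ->
  Num.min (Splus_value R n) (Hn_value R n) < RRR R e.
Proof.
move=> c4 p1; have [|y yC ky_gt2] := exists_branching k_gt0 sum_k; first by rewrite p1.
have ky : k y = #|C|.-1 by have := core_deg_lt simple_e yC; lia.
have y_ge2 : 2 <= rho y by have := rho_ge yC; rewrite ky c4 /=; lra.
have D3 : #|C :\ y| = 3%N by apply/eqP; rewrite -(eqn_add2l (y \in C)) -cardsD1 c4 yC.
have sumD : \sum_(v in C :\ y) (rho v - 1) = n%:R - rho y - 3.
  by rewrite sumrB sumr_const D3 -sum_rho (big_setD1 y yC) /=; ring.
have D_ge0 v : v \in C :\ y -> 0 <= rho v - 1.
  by rewrite in_setD1 subr_ge0 ler1n => /andP[_ /reduced_deg_gt0].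
have := sqrt1D_sum D_ge0; rewrite sumD sumrB sumr_const D3.
rewrite (eq_bigr (fun v => Num.sqrt (rho v))) => [|v _]; last by rewrite subrKC.
move=> merged; have rest_ge0 : 0 <= n%:R - rho y - 3 by rewrite -sumD sumr_ge0.
have /(triangle_pendant_gap y_ge2) : 0 < n%:R - rho y - 2 by lra.
have -> : rho y + (n%:R - rho y - 2) = (n - 2)%:R by rewrite natrB; [ring | lia].
have -> : (n - 2)%:R - 3 = (n - 5)%:R :> R.
  have n_ge5 : 5 <= n%:R :> R by lra.
  by rewrite !natrB; [ring | rewrite -(ler_nat R) | lia].
move: (dominating_bound R simple_e sum_k yC ky) merged.
rewrite (_ : 1 + (n%:R - rho y - 3) = n%:R - rho y - 2); last by ring.
move=> dom merged gap; have sqrt_y_ge0 := sqrtr_ge0 (rho y).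
rewrite /Splus_value /Hn_value -[1 + 3 * _ + _]addrA -addr_minr.
apply: lt_le_trans dom; rewrite ltrD2l (lt_le_trans gap) // ler_wpM2l //; lra.
Qed.

Lemma hub_reduced_deg v : v \in C -> leaf_hub e v ->
  (reduced_deg e v + 1 + #|C| = n + k v)%N.
Proof.
move=> vC v_hub.
have rest : (\sum_(u in C | u != v) (reduced_deg e u + 1) =
             \sum_(u in C | u != v) k u)%N.
  apply: eq_bigr => u /andP[uC uv]; rewrite addn1 v_hub // prednK //.
  by rewrite -v_hub // k_gt0.
have : (\sum_(u in C) (reduced_deg e u + 1) = n + #|C|)%N.
  by rewrite big_split /= sum_reduced_deg_unicyclic sum1_card.
have : (k v + \sum_(u in C | u != v) k u = 2 * #|C|)%N by rewrite -sum_k (bigD1 v vC).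
rewrite (bigD1 v vC) /= rest.
by move: (\sum_(u in C | u != v) k u)%N #|C|; lia.
Qed.

Section HnCore.
Hypothesis n_gt6 : (6 < n)%N.
Hypothesis card_C : #|C| = 5%N.
Hypothesis card_P : #|P| = 1%N.
Hypothesis leafless_C : forall v, v \in C -> k v != 1%N -> leafless e v.
Hypothesis edge_reduced_deg : forall x y, x \in C -> y \in C -> e x y ->
  (reduced_deg e x == 1%N) || (reduced_deg e y == 1%N).

Lemma Hn_core_seq :
  exists y a b w v, let r := [:: y; a; b; w; v] in
    [/\ uniq r, C =i r, map k r = [:: 3; 2; 2; 2; 1]%N, e w v & leaf_hub e v].
Proof.
have [y yC [ky others]] := unique_branching k_gt0 sum_k card_P.
have /cards1P[v PE] : #|P| == 1%N by rewrite card_P.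
have kP u : u \in C -> (k u == 1%N) = (u == v).
  by move=> uC; have /setP/(_ u) := PE; rewrite in_set1 in_set uC.
have vC : v \in C by have := set11 v; rewrite -PE in_set => /andP[].
have kv : k v = 1%N by apply/eqP; rewrite kP.
have k2 u : u \in C -> u != y -> u != v -> k u = 2%N.
  by move=> uC uy; rewrite -kP // => ku; have := others u uC uy; have := k_gt0 uC; lia.
have v_hub : leaf_hub e v by move=> u uC; rewrite -kP //; exact: leafless_C.
have red_y : reduced_deg e y = 2%N by rewrite /reduced_deg -leafless_C ?ky.
have [w wC evw] : exists2 w, w \in C & e v w.
  by have /card_gt0P[w] := k_gt0 vC; rewrite inE => /andP[wC evw]; exists w.
have wv : w != v by apply: contraTneq evw => ->; rewrite e_irr.
have wy : w != y.
  apply: contraTneq evw => ->; apply/negP => evy.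
  have := edge_reduced_deg vC yC evy; rewrite red_y orbF => /eqP red_v.
  by have := hub_reduced_deg vC v_hub; rewrite red_v kv card_C; lia.
have yv : y != v by rewrite -kP ?ky.
have sub_C : v |: [set y; w] \subset C.
  by apply/subsetP => u /setU1P[->//|/set2P[]->].
have /cards2P[a [b [ab DE]]] : #|C :\: (v |: [set y; w])| == 2%N.
  rewrite cardsDS // card_C cardsU1 cards2 in_set2 negb_or !(eq_sym v) yv wv.
  by rewrite (eq_sym y) wy.
have memD u : (u \in [set a; b]) = [&& u != v, u != y, u != w & u \in C].
  by rewrite -DE in_setD in_setU1 in_set2 !negb_or -!andbA.
have /and4P[neq_av neq_ay neq_aw aC] : [&& a != v, a != y, a != w & a \in C].
  by rewrite -memD set21.
have /and4P[neq_bv neq_by neq_bw bC] : [&& b != v, b != y, b != w & b \in C].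
  by rewrite -memD set22.
have uniq_r : uniq [:: y; a; b; w; v].
  rewrite /= !inE !negb_or ab neq_aw neq_av neq_bw neq_bv wv yv !(eq_sym y).
  by rewrite neq_ay neq_by wy.
exists y, a, b, w, v; split=> //; last by rewrite e_sym.
- apply/fsym/subset_cardP; first by rewrite (card_uniqP uniq_r) card_C.
  by apply/subsetP/allP; rewrite /= yC aC bC wC vC.
- by rewrite /= ky kv !k2.
Qed.

Lemma Hn_core_adjacency y a b w v : let r := [:: y; a; b; w; v] in
    uniq r -> C =i r -> map k r = [:: 3; 2; 2; 2; 1]%N -> e w v ->
  forall i j, (i < j < 5)%N -> e (nth v r i) (nth v r j) = Hn_rel i j.
Proof.
move=> r uniq_r rE [ky ka kb kw kv] ewv.
have := core_deg_seq y uniq_r rE; have := core_deg_seq a uniq_r rE.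
have := core_deg_seq b uniq_r rE; have := core_deg_seq w uniq_r rE.
have := core_deg_seq v uniq_r rE.
rewrite ky ka kb kw kv /= !e_irr.
rewrite (e_sym a y) (e_sym b y) (e_sym w y) (e_sym v y) (e_sym b a).
rewrite (e_sym w a) (e_sym v a) (e_sym w b) (e_sym v b) (e_sym v w) ewv.
case eyv: (e y v); case eav: (e a v); case ebv: (e b v) => //.
case eya: (e y a); case eyb: (e y b); case eyw: (e y w) => //.
case eab: (e a b); case eaw: (e a w); case ebw: (e b w) => // _ _ _ _ _.
by move=> [|[|[|[|[|i]]]]] [|[|[|[|[|j]]]]] //= /andP[].
Qed.

Lemma Hn_core_isomorphic : isomorphic e (@Hn n).
Proof.
have [y [a [b [w [v [uniq_r rE k_r ewv v_hub]]]]]] := Hn_core_seq.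
apply/(isomorphic_HnP _ (ltnW (ltnW n_gt6))); exists [:: y; a; b; w; v]; split=> //.
apply: (core_realizes n_gt2 simple_e connected_e (c := v)) => //.
- by move=> i j; rewrite /Hn_rel orbC.
- by move=> i; rewrite /Hn_rel /H_half; lia.
- by rewrite !inE eqxx !orbT.
- have -> : index v [:: y; a; b; w; v] = 4%N by exact: (index_last uniq_r).
  by case=> [|[|[|[|[|]]]]].
exact: Hn_core_adjacency.
Qed.

End HnCore.

Lemma RRR_trichotomy :
  [\/ Splus_value R n <= RRR R e /\
        (RRR R e = Splus_value R n -> isomorphic e (@Splus n)),
      Hn_value R n <= RRR R e /\
        ((6 < n)%N -> RRR R e = Hn_value R n -> isomorphic e (@Hn n)) |
      Num.min (Splus_value R n) (Hn_value R n) < RRR R e].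
Proof.
have [p0|p_gt0] := posnP #|P|.
  have no_p : P = set0 by apply/eqP; rewrite -cards_eq0 p0.
  by apply: Or31; split; [exact: cycle_RRR_ge | exact: cycle_isomorphic].
have := core_card_gt3 p_gt0; have [six|] := leqP 6 (#|C| + #|P|) => c_gt3.
  apply: Or32; split=> [|n_gt6]; first exact: branching_RRR_ge.
  by move/(branching_RRR_eq p_gt0 six) => []; exact: Hn_core_isomorphic.
by move=> cp_le; apply/Or33/triangle_pendant_RRR_gt; lia.
Qed.

Lemma RRR_small : (n <= 16)%N ->
  Splus_value R n <= RRR R e /\
  (RRR R e = Splus_value R n <-> isomorphic e (@Splus n)).
Proof.
move=> /(Splus_value_lt_Hn R) gap.
have [le_RRR eq_iso] : Splus_value R n <= RRR R e /\
    (RRR R e = Splus_value R n -> isomorphic e (@Splus n)).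
  case: RRR_trichotomy => [//|[le_Hn _]|]; last rewrite (min_l (ltW gap)) => lt_RRR.
    by split=> [|RRR_eq]; [|exfalso]; lra.
  by split=> [|RRR_eq]; [|exfalso]; lra.
by split=> //; split=> //; exact: RRR_Splus.
Qed.

Lemma RRR_large : (17 <= n)%N ->
  Hn_value R n <= RRR R e /\ (RRR R e = Hn_value R n <-> isomorphic e (@Hn n)).
Proof.
move=> n_ge17; have gap := Hn_value_lt_Splus R n_ge17.
have n_gt6 : (6 < n)%N by lia.
have [le_RRR eq_iso] : Hn_value R n <= RRR R e /\
    (RRR R e = Hn_value R n -> isomorphic e (@Hn n)).
  case: RRR_trichotomy => [[le_Splus _]|[le_Hn eq_iso]|].
  - by split=> [|RRR_eq]; [|exfalso]; lra.
  - by split=> //; exact: eq_iso.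
  rewrite (min_r (ltW gap)) => lt_RRR.
  by split=> [|RRR_eq]; [|exfalso]; lra.
by split=> //; split=> // /RRR_Hn->; rewrite // ltnW.
Qed.

End Unicyclic.

Theorem theorem1 (R : rcfType) (n : nat) (e : rel 'I_n) :
  (4 <= n)%N -> unicyclic e ->
  ((n <= 16)%N ->
     1 + 2 * Num.sqrt ((n - 2)%N%:R) <= RRR R e /\
     (RRR R e = 1 + 2 * Num.sqrt ((n - 2)%N%:R) <-> isomorphic e (@Splus n))) /\
  ((17 <= n)%N ->
     1 + 3 * Num.sqrt 2 + Num.sqrt ((n - 5)%N%:R) <= RRR R e /\
     (RRR R e = 1 + 3 * Num.sqrt 2 + Num.sqrt ((n - 5)%N%:R) <-> isomorphic e (@Hn n))).
Proof.
move=> n_ge4 unicyclic_e.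
by split; [exact: (RRR_small R n_ge4) | exact: (RRR_large R n_ge4)].
Qed.
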